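(* Let $F$ be a free group of finite rank $n$ with free basis $X$ and let $H$ be a subgroup of $F$. Let $\mathcal T$ be a Schreier transversal for $H$ in $F$, regarded as a spanning tree of the cosets graph of $H$, and let $\mathcal T_i$ ($i=1,2,\ldots$) be finite subgraphs of $\mathcal T$ such that $\mathcal T=\liminf \mathcal T_i$. Then $$\operatorname{rank}(H)=\lim_{i\to\infty}\left(\alpha(\mathcal T_i)+(n-1)|V(\mathcal T_i)|-\frac12\sum_{j=1}^{\alpha(\mathcal T_i)}|V(\partial_{out}\mathcal T_{i,j})|\right),$$ where $\alpha(\mathcal T_i)$ is the number of connected components of $\mathcal T_i$ and, for fixed $i$, $\partial_{out}\mathcal T_{i,j}$ is the outer boundary in $\mathcal T$ of the connected component $\mathcal T_{i,j}$ of $\mathcal T_i$, $j=1,\ldots,\alpha(\mathcal T_i)$. (Both sides are $\infty$ when $H$ is not finitely generated.)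
   Context: The cosets graph $\mathcal G$ of $H$ (with respect to $X$) has as vertices the right cosets $Hg$, $g\in F$; for each coset $Hg$ and each $x\in X$ there is one (two-way) edge joining $Hg$ to $Hgx$, labeled $x$ in the direction from $Hg$ to $Hgx$ and $x^{-1}$ in the opposite direction (loops and multiple edges are allowed). A Schreier transversal for $H$ in $F$ is a set $\mathcal T$ of representatives of the right cosets of $H$, written as reduced words in $X\cup X^{-1}$, containing $1$ (representing $H$) and such that every initial segment of an element of $\mathcal T$ is in $\mathcal T$. Equivalently, it is a spanning tree of $\mathcal G$ rooted at the vertex $H$, each vertex being labeled by the word read along the tree path from the root to it; the same letter $\mathcal T$ denotes the tree and the set of its vertex labels. $V(\cdot)$ and $E(\cdot)$ denote vertex and edge sets. For subgraphs $\mathcal T_i$ of $\mathcal T$, $\mathcal T=\liminf\mathcal T_i$ means $V(\mathcal T)=\bigcup_{i\ge1}\bigcap_{j\ge i}V(\mathcal T_j)$ and $E(\mathcal T)=\bigcup_{i\ge1}\bigcap_{j\ge i}E(\mathcal T_j)$. The outer boundary in $\mathcal T$ of a subgraph $\mathcal H$ of $\mathcal T$ is the set of vertices of $\mathcal T$ not in $\mathcal H$ that are adjacent in $\mathcal T$ to a vertex of $\mathcal H$. *)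

(* Defs.v *)
From mathcomp Require Export all_boot all_order all_algebra.
From mathcomp Require Export all_classical all_reals all_analysis.
From mathcomp Require Export finmap.
From Stdlib Require Export Relation_Operators.
Set Implicit Arguments.
Unset Strict Implicit.
Unset Printing Implicit Defensive.

Import Order.TTheory GRing.Theory Num.Theory.
Local Open Scope classical_set_scope.
Local Open Scope group_scope.

Definition ncard (T : choiceType) (A : set T) : nat := #|` fset_set A|.

Section Words.
Variable F : groupType.

(* (x, true) stands for the letter x and (x, false) for the letter x^-1. *)
Definition word : Type := seq (F * bool).

Definition letter_value (l : F * bool) : F := if l.2 then l.1 else l.1^-1.

Definition value (w : word) : F := \prod_(l <- w) letter_value l.

Definition words_over (B : set F) : set word :=
  [set w | forall l, l \in w -> B l.1].

Definition reduced (w : word) : bool :=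
  sorted [rel a b : F * bool | ~~ ((a.1 == b.1) && (a.2 != b.2))] w.

Definition generated_by (B : set F) : set F := value @` words_over B.

Definition finitely_generated (H : set F) : Prop :=
  exists2 B : set F, finite_set B & generated_by B = H.

(* H is a free group with free basis B. *)
Definition free_basis (H B : set F) : Prop :=
  generated_by B = H /\
  forall w, words_over B w -> reduced w -> value w = 1 -> w = [::].

(* The cardinality (possibly +oo) of a free basis of H. Every subgroup of a
   free group has a free basis (Nielsen-Schreier) and all of them have the same
   cardinality, so that the choice made by xget is immaterial. *)
Definition rank (R : realType) (H : set F) : \bar R :=
  counting (xget set0 (free_basis H)).

Definition right_coset (H : set F) (g : F) : set F := [set h * g | h in H].

Definition schreier_transversal (X H : set F) (T : set word) : Prop :=
  [/\ T `<=` [set w | words_over X w /\ reduced w],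
      forall g, exists! w, T w /\ right_coset H g (value w),
      T [::]
    & forall u v, T (u ++ v) -> T u].

End Words.

(* Subgraphs of a multigraph with vertices in V, edges in E and endpoints given
   by ends; the orientation implicit in ends is ignored by adjacency. *)
Record graph (V E : Type) := Graph { verts : set V; edges : set E }.

Section Graphs.
Variables (V E : choiceType) (ends : E -> V * V).
Implicit Types G K : graph V E.

Definition subgraph G K : Prop :=
  [/\ verts G `<=` verts K, edges G `<=` edges K
    & forall e, edges G e -> verts G (ends e).1 /\ verts G (ends e).2].

Definition finite_graph G : Prop :=
  finite_set (verts G) /\ finite_set (edges G).

Definition adjacent G (u v : V) : Prop :=
  exists2 e, edges G e & ends e = (u, v) \/ ends e = (v, u).

(* The vertex sets of the connected components of G. *)
Definition components G : set (set V) :=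
  [set [set v | clos_refl_trans V (adjacent G) u v] | u in verts G].

Definition alpha G : nat := ncard (components G).

(* The outer boundary in K of a subgraph of K with vertex set C. *)
Definition outer_boundary K (C : set V) : set V :=
  [set v | [/\ verts K v, ~ C v & exists2 u, C u & adjacent K u v]].

Definition is_liminf K (G : nat -> graph V E) : Prop :=
  verts K = \bigcup_i \bigcap_(j in [set j | (i <= j)%N]) verts (G j) /\
  edges K = \bigcup_i \bigcap_(j in [set j | (i <= j)%N]) edges (G j).

End Graphs.

Section CosetsGraph.
Variable F : groupType.
Implicit Types (X H : set F) (T : set (word F)).

(* The pair (Hg, x) stands for the two-way edge joining Hg to Hgx. *)
Definition coset_ends (e : set F * F) : set F * set F :=
  (e.1, [set g * e.2 | g in e.1]).

Definition cosets_graph X H : graph (set F) (set F * F) :=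
  Graph (range (right_coset H)) [set e | range (right_coset H) e.1 /\ X e.2].

(* The edge of the cosets graph traversed when reading l from H * value w. *)
Definition last_edge H (w : word F) (l : F * bool) : set F * F :=
  (right_coset H (value w * (if l.2 then 1 else l.1^-1)), l.1).

Definition schreier_tree X H T : graph (set F) (set F * F) :=
  Graph (verts (cosets_graph X H))
        [set e | exists w l, T (rcons w l) /\ e = last_edge H w l].

End CosetsGraph.

(* Main.v *)
Require Import Defs.
From Stdlib Require Operators_Properties.
From mathcomp Require Import zify lra.
Set Implicit Arguments.
Unset Strict Implicit.
Unset Printing Implicit Defensive.

Import Order.TTheory GRing.Theory Num.Theory.
Local Open Scope classical_set_scope.
Local Open Scope group_scope.

(* The boundary formula counts ends of edges.  In the cosets graph every vertex
   is an end of 2n edges; inside a component with c vertices the tree T has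
   c - 1 edges, and one further edge for each boundary vertex.  Hence the i-th
   term of the sequence is half the number of ends, lying in T_i, of edges of
   the cosets graph outside T.  Every such edge eventually has both ends in T_i,
   so the limit is the number of edges outside T.
   These edges index the Schreier generators, which generate H.  They form a
   free basis: the word in X that runs through the loops of a given word u in
   the Schreier generators crosses the edges outside T in the order prescribed
   by u, and cancelling a pair of letters of X cancels or leaves alone a pair of
   crossings.  That any two free bases have the same cardinality is linear
   algebra on exponent sums. *)

(** * Free reduction of words in letters and their formal inverses *)

Section FreeReduction.
Variable A : eqType.
Implicit Types (l : A * bool) (u v w : seq (A * bool)).

Definition linv l : A * bool := (l.1, ~~ l.2).

Definition winv w : seq (A * bool) := rev (map linv w).

(** The condition [reduced] over an arbitrary alphabet, because it is also applied to words whose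
    letters are edges. *)
Definition freely_reduced w : bool :=
  sorted [rel a b : A * bool | ~~ ((a.1 == b.1) && (a.2 != b.2))] w.

#[local] Arguments freely_reduced : simpl never.

(** Left multiplication by a letter in the free group, acting on reduced words (van der Waerden's
    trick); [normal_form] lets a word act on the empty word. *)
Definition push l w :=
  if w is l' :: w' then if l' == linv l then w' else l :: w else [:: l].

Definition normal_form w := foldr push [::] w.

Lemma linvK : involutive linv.
Proof. by case=> a b; rewrite /linv /= negbK. Qed.

Lemma eq_linv l l' : (l.1 == l'.1) && (l.2 != l'.2) = (l' == linv l).
Proof. by case: l l' => [a b] [a' b']; rewrite xpair_eqE /= eq_sym; case: b b' => -[]. Qed.

Lemma freely_reduced_cons2 l l' w :
  freely_reduced [:: l, l' & w] = (l' != linv l) && freely_reduced (l' :: w).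
Proof. by rewrite /freely_reduced /= eq_linv. Qed.

Lemma freely_reduced_behead l w : freely_reduced (l :: w) -> freely_reduced w.
Proof. exact: path_sorted. Qed.

Lemma push_reduced l w : freely_reduced w -> freely_reduced (push l w).
Proof.
case: w => //= l' w red; case: ifPn => [_|ll'].
  exact: freely_reduced_behead red.
by rewrite freely_reduced_cons2 ll'.
Qed.

Lemma normal_form_reduced w : freely_reduced (normal_form w).
Proof. by elim: w => //= l w; exact: push_reduced. Qed.

(** If [w] starts with [l], pushing [linv l] removes that letter, and reducedness keeps the next
    letter from being [linv l], so pushing [l] restores [w]. *)
Lemma push_linvK l w : freely_reduced w -> push l (push (linv l) w) = w.
Proof.
case: w => /= [|l' w red]; first by rewrite eqxx.
rewrite linvK; have [<-|ll'] := eqVneq l' l; last by rewrite /= eqxx.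
case: w red => // l2 w; rewrite freely_reduced_cons2 => /andP[/negbTE] /= -> _.
by [].
Qed.

Lemma normal_form_id w : freely_reduced w -> normal_form w = w.
Proof.
elim: w => //= l w IH red; rewrite IH; last exact: freely_reduced_behead red.
by case: w red {IH} => // l' w; rewrite freely_reduced_cons2 => /andP[/negbTE] /= ->.
Qed.

Lemma normal_form_cat u v : normal_form (u ++ v) = foldr push (normal_form v) u.
Proof. exact: foldr_cat. Qed.

Lemma normal_form_cancel u l v :
  normal_form (u ++ [:: l, linv l & v]) = normal_form (u ++ v).
Proof. by rewrite !normal_form_cat /= push_linvK ?normal_form_reduced. Qed.

Lemma not_reduced_cancel w : ~~ freely_reduced w ->
  exists u l v, w = u ++ [:: l, linv l & v].
Proof.
elim: w => // l [|l' w] // IH; rewrite freely_reduced_cons2 negb_and negbK.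
case/orP=> [/eqP->|/IH[u [l0 [v ->]]]]; first by exists [::], l, w.
by exists (l :: u), l0, v.
Qed.

Lemma winv_cons l w : winv (l :: w) = rcons (winv w) (linv l).
Proof. by rewrite /winv map_cons rev_cons. Qed.

Lemma mem_winv w l : (l \in winv w) = (linv l \in w).
Proof.
rewrite /winv mem_rev -{1}[l]linvK mem_map //; exact: can_inj linvK.
Qed.

End FreeReduction.

(** * Evaluation of words in a group, and cancellation in words of value 1 *)

Section Value.
Variable F : groupType.
Implicit Types (l : F * bool) (u v w : word F) (B : set F).

Lemma value_nil : value [::] = 1 :> F.
Proof. exact: big_nil. Qed.

Lemma value_cons l w : value (l :: w) = letter_value l * value w.
Proof. exact: big_cons. Qed.

Lemma value_cat u v : value (u ++ v) = value u * value v.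
Proof. exact: big_cat. Qed.

Lemma value_rcons w l : value (rcons w l) = value w * letter_value l.
Proof. by rewrite -cats1 value_cat value_cons value_nil mulg1. Qed.

Lemma letter_value_linv l : letter_value (linv l) = (letter_value l)^-1.
Proof. by case: l => a [] //; rewrite /letter_value /= invgK. Qed.

Lemma value_winv w : value (winv w) = (value w)^-1.
Proof.
elim: w => [|l w IH]; first by rewrite value_nil invg1.
by rewrite winv_cons value_rcons value_cons invgM IH letter_value_linv.
Qed.

Lemma value_cancel u l v : value (u ++ [:: l, linv l & v]) = value (u ++ v).
Proof. by rewrite !value_cat !value_cons letter_value_linv mulVKg. Qed.

Lemma words_over_cat B u v :
  words_over B (u ++ v) <-> words_over B u /\ words_over B v.
Proof.
split=> [H|[Hu Hv] l]; last by rewrite mem_cat => /orP[/Hu|/Hv].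
by split=> l lw; apply: H; rewrite mem_cat lw ?orbT.
Qed.

Lemma words_over_cons B l w :
  words_over B (l :: w) <-> B l.1 /\ words_over B w.
Proof.
split=> [H|[Hl Hw] l']; last by rewrite inE => /predU1P[->|/Hw].
by split=> [|l' lw]; apply: H; rewrite inE ?eqxx ?lw ?orbT.
Qed.

Lemma words_over_winv B w : words_over B w -> words_over B (winv w).
Proof. by move=> Bw l; rewrite mem_winv => /Bw. Qed.

Lemma generated_by_sub B b : B b -> generated_by B b.
Proof.
move=> Bb; exists [:: (b, true)]; last by rewrite value_cons value_nil mulg1.
by move=> l; rewrite inE => /eqP->.
Qed.

(** By freeness a nonempty word over [B] of value 1 is not reduced, so it contains a cancelling
    pair, whose deletion leaves a shorter word of value 1. *)
Lemma free_cancel_ind B (P : word F -> Prop) :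
  (forall w, words_over B w -> reduced w -> value w = 1 -> w = [::]) ->
  P [::] ->
  (forall u l v, P (u ++ v) -> P (u ++ [:: l, linv l & v])) ->
  forall w, words_over B w -> value w = 1 -> P w.
Proof.
move=> freeB P0 PS w; have [m] := ubnP (size w); elim: m w => // m IH w sw Bw w1.
have [red|/not_reduced_cancel[u [l [v wE]]]] := boolP (reduced w).
  by rewrite (freeB w).
rewrite wE; apply: PS; apply: IH; first last.
- by rewrite -(value_cancel u l) -wE.
- move: Bw; rewrite wE => /words_over_cat[Bu /words_over_cons[_]].
  by move=> /words_over_cons[_ Bv]; apply/words_over_cat.
- by move: sw; rewrite wE !size_cat /= !addnS !ltnS => /ltnW.
Qed.

End Value.

(** * Exponent sums, and the comparison of a free basis with a generating set *)

Section ExponentSum.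
Local Open Scope ring_scope.

(** The homomorphism to [V] from the free group on [A] that extends [phi], evaluated on words. *)
Definition exponent_sum (A : Type) (V : zmodType) (phi : A -> V)
    (w : seq (A * bool)) : V :=
  \sum_(l <- w) (if l.2 then phi l.1 else - phi l.1).

Lemma exponent_sum_cat (A : Type) (V : zmodType) (phi : A -> V) u v :
  exponent_sum phi (u ++ v) = exponent_sum phi u + exponent_sum phi v.
Proof. exact: big_cat. Qed.

Lemma exponent_sum_winv (A : eqType) (V : zmodType) (phi : A -> V) w :
  exponent_sum phi (winv w) = - exponent_sum phi w.
Proof.
rewrite /exponent_sum /winv big_rev big_map -sumrN.
by apply: eq_bigr => -[a []] _ //=; rewrite opprK.
Qed.

Lemma exponent_sum_cancel (A : eqType) (V : zmodType) (phi : A -> V) u l v :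
  exponent_sum phi (u ++ [:: l, linv l & v]) = exponent_sum phi (u ++ v).
Proof.
rewrite !exponent_sum_cat; congr (_ + _).
rewrite /exponent_sum !big_cons; case: l => a [] /=; first by rewrite addNKr.
by rewrite addKr.
Qed.

Variables (F : groupType) (H B : set F).
Hypothesis freeB : free_basis H B.

(** The word [u ++ winv v] has value 1, hence cancels to nothing, and cancellation preserves
    exponent sums. *)
Lemma exponent_sum_value (V : zmodType) (phi : F -> V) u v :
  words_over B u -> words_over B v -> value u = value v ->
  exponent_sum phi u = exponent_sum phi v.
Proof.
move=> Bu Bv uv; apply/subr0_eq; rewrite -exponent_sum_winv -exponent_sum_cat.
move: (u ++ winv v) (words_over_cat B u (winv v)) (value_cat u (winv v)) => w Bw.
rewrite value_winv uv mulgV => w1.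
apply: (free_cancel_ind (P := fun w => exponent_sum phi w = 0) freeB.2) w1.
- exact: big_nil.
- by move=> *; rewrite exponent_sum_cancel.
- by apply/Bw; split=> //; exact: words_over_winv.
Qed.

(* A function on B whose exponent sum vanishes on a generating set has
   vanishing exponent sum everywhere, so exponent sums embed the rational
   functions on B linearly into those on the generating set. *)
Lemma free_basis_leq_generators (C : set F) (m k : nat)
    (b : 'I_m -> F) (c : 'I_k -> F) :
  injective b -> (forall i, B (b i)) ->
  generated_by C = H -> C `<=` range c -> (m <= k)%N.
Proof.
move=> injb Bb genC Cc.
have HB h : H h -> exists2 w, words_over B w & value w = h.
  by rewrite -freeB.1.
pose good (j : 'I_k) (w : word F) := words_over B w /\ value w = c j.
(* Indices [j] with [c j] outside [C] may receive the default empty word; they only add columns to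
   the matrix below. *)
pose wc j := xget [::] (good j).
have wcP j : C (c j) -> good j (wc j).
  move=> Cj; apply: (xgetPex [::]).
  have [|w Bw wj] := HB (c j); last by exists w.
  by rewrite -genC; exact: generated_by_sub.
pose delta i (x : F) : rat := (x == b i)%:R.
pose E : 'M[rat]_(m, k) := \matrix_(i, j) exponent_sum (delta i) (wc j).
suff /eqP <- : row_free E by exact: rank_leq_col.
apply: inj_row_free => v vE0.
(* The function on the basis with coordinates [v]; that [v] lies in the left kernel of [E] says that
   its exponent sum vanishes on all chosen words. *)
pose phi (x : F) : rat := \sum_i v ord0 i * delta i x.
have phiE w : exponent_sum phi w = \sum_i v ord0 i * exponent_sum (delta i) w.
  rewrite /exponent_sum /phi; under [RHS]eq_bigr do rewrite mulr_sumr.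
  rewrite exchange_big /=; apply: eq_bigr => l _.
  case: l.2 => //; rewrite -sumrN; by under [RHS]eq_bigr do rewrite mulrN.
have phic j : exponent_sum phi (wc j) = 0.
  have := congr1 (fun r : 'rV_k => r ord0 j) vE0; rewrite !mxE => <-.
  by rewrite phiE; apply: eq_bigr => i _; rewrite mxE.
have phi0 w : words_over C w ->
    exists w', [/\ words_over B w', value w' = value w & exponent_sum phi w' = 0].
  elim: w => [_|l w IH /words_over_cons[Cl /IH[w' [Bw' w'w w'0]]]].
    by exists [::]; split=> //; exact: big_nil.
  have [j _ jl] := Cc _ Cl; rewrite -jl in Cl.
  have [Bj jv] := wcP j Cl.
  exists ((if l.2 then wc j else winv (wc j)) ++ w'); split.
  - by apply/words_over_cat; split=> //; case: l.2 => //; exact: words_over_winv.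
  - rewrite value_cat value_cons w'w /letter_value -jl -jv.
    by case: l.2 => //; rewrite value_winv.
  - rewrite exponent_sum_cat w'0 addr0; case: l.2 => //.
    by rewrite exponent_sum_winv phic oppr0.
apply/rowP => i; rewrite mxE.
(* The element [b i] is spelled both by a word over [B] of exponent sum 0 and by a single letter,
   whose exponent sum is the coordinate of [v] at [i]. *)
have : H (b i) by rewrite -freeB.1; exact: generated_by_sub.
rewrite -genC => -[w /phi0[w' [Bw' w'w w'0]] wi].
have Bbi : words_over B [:: (b i, true)] by move=> l; rewrite inE => /eqP->; exact: Bb.
have vbi : value w' = value [:: (b i, true)].
  by rewrite w'w wi value_cons value_nil mulg1.
have := exponent_sum_value phi Bw' Bbi vbi; rewrite w'0 => /esym.
rewrite /exponent_sum big_seq1 /= => <-.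
rewrite /phi (bigD1 i) //= /delta eqxx mulr1 big1 ?addr0 // => i' i'i.
by rewrite (inj_eq injb) eq_sym (negbTE i'i) mulr0.
Qed.

(** Only a finite subset [D] of [B] is compared, because [B] is not known to be finite at this
    point. *)
Lemma free_basis_fset_leq_generators (C : set F) (D : {fset F}) :
  [set` D] `<=` B -> generated_by C = H -> finite_set C ->
  (#|` D| <= ncard C)%N.
Proof.
move=> DB genC finC; pose c (s : {fset F}) (i : 'I_#|` s|) := nth 1%g s i.
have inD (s : {fset F}) (i : 'I_#|` s|) : c s i \in s by exact: mem_nth.
apply: (@free_basis_leq_generators C _ _ (c D) (c (fset_set C))) => //.
- by move=> i j /eqP; rewrite nth_uniq ?fset_uniq // => /eqP/val_inj.
- by move=> i; apply: DB; exact: inD.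
- move=> x Cx; have xC : x \in fset_set C by rewrite in_fset_set //; exact/mem_set.
  have ix : (index x (fset_set C) < #|` fset_set C|)%N by rewrite index_mem.
  by exists (Ordinal ix) => //; exact: nth_index.
Qed.

End ExponentSum.

(** * Independence of the rank from the choice of a free basis *)

Section FreeBasisCard.
Variables (F : groupType) (H B : set F).
Hypothesis freeB : free_basis H B.

Lemma finitely_generated_free_basis : finitely_generated H -> finite_set B.
Proof.
move=> [C finC genC]; apply: contrapT => infB.
have [D DB] := infinite_set_fset (ncard C).+1 infB.
by rewrite ltnNge (free_basis_fset_leq_generators freeB DB genC finC).
Qed.

Lemma free_basis_ncard_le (C : set F) :
  generated_by C = H -> finite_set C -> (ncard B <= ncard C)%N.
Proof.
move=> genC finC; apply: (free_basis_fset_leq_generators freeB _ genC finC).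
by rewrite fset_setK //; apply: finitely_generated_free_basis; exists C.
Qed.

End FreeBasisCard.

(** Finiteness passes between two free bases since each generates [H]; finite ones are then compared
    in both directions, and on infinite ones [counting] is infinite. *)
Lemma rank_free_basis (R : realType) (F : groupType) (H B : set F) :
  free_basis H B -> rank R H = counting B.
Proof.
move=> freeB; rewrite /rank.
have : free_basis H (xget set0 (free_basis H)) by apply: xgetPex; exists B.
move: (xget _ _) => C freeC; rewrite /counting.
have finBC : finite_set B <-> finite_set C.
  split=> fin.
    by apply: (finitely_generated_free_basis freeC); exists B; first exact: fin; exact: freeB.1.
  by apply: (finitely_generated_free_basis freeB); exists C; first exact: fin; exact: freeC.1.
case: asboolP => [finC|infC]; case: asboolP => [finB|infB] //; last 2 first.
- by case: infB; exact/finBC.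
- by case: infC; exact/finBC.
congr (_%:R%:E); apply/eqP; rewrite eqn_leq.
by rewrite (free_basis_ncard_le freeC freeB.1) ?(free_basis_ncard_le freeB freeC.1).
Qed.

(** * The Schreier generators form a free basis of the subgroup *)

Section Schreier.
Variables (F : groupType) (X H : set F) (T : set (word F)).
Hypotheses (hX : free_basis [set: F] X) (hH : group_closed [in H])
  (hT : schreier_transversal X H T).
Implicit Types (c : set F) (l : F * bool) (e : set F * F).
Local Notation tree := (schreier_tree X H T).
Local Notation vertex := (range (right_coset H)).

Definition step c l : set F := [set g * letter_value l | g in c].

(** The edge traversed on leaving [c] along [l]. Edges are stored at the origin of their positive
    letter, so an inverse letter names its edge by the vertex it reaches. *)
Definition edge_of c l : set F * F := (if l.2 then c else step c l, l.1).

Definition coset_of_word (w : word F) : set F := right_coset H (value w).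

Definition rep c : word F := xget [::] [set w | T w /\ coset_of_word w = c].

Definition nontree : set (set F * F) :=
  edges (cosets_graph X H) `\` edges tree.

Definition schreier_gen e : F :=
  value (rep e.1) * e.2 * (value (rep (coset_ends e).2))^-1.

Lemma stepK c l : step (step c l) (linv l) = c.
Proof.
rewrite /step image_comp -[RHS]image_id; apply: eq_imagel => g _ /=.
by rewrite letter_value_linv mulgK.
Qed.

Lemma step_linvK c l : step (step c (linv l)) l = c.
Proof. by rewrite -{2}[l]linvK stepK. Qed.

Lemma step_right_coset g l :
  step (right_coset H g) l = right_coset H (g * letter_value l).
Proof.
rewrite /step /right_coset image_comp; apply: eq_imagel => h _ /=.
by rewrite mulgA.
Qed.

Lemma step_rcons w l : step (coset_of_word w) l = coset_of_word (rcons w l).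
Proof. by rewrite step_right_coset /coset_of_word value_rcons. Qed.

Lemma foldl_step_right_coset g w :
  foldl step (right_coset H g) w = right_coset H (g * value w).
Proof.
elim: w g => [|l w IH] g /=; first by rewrite value_nil mulg1.
by rewrite step_right_coset IH value_cons mulgA.
Qed.

Lemma foldl_step_winv c w : foldl step (foldl step c w) (winv w) = c.
Proof.
elim: w c => //= l w IH c.
by rewrite winv_cons foldl_rcons IH stepK.
Qed.

Lemma edge_of_linv c l : edge_of (step c l) (linv l) = edge_of c l.
Proof. by rewrite /edge_of stepK; case: l => a []. Qed.

Lemma coset_ends_edge_of c l :
  coset_ends (edge_of c l) = if l.2 then (c, step c l) else (step c l, c).
Proof.
case: l => a [] //=; rewrite /coset_ends /edge_of /=; congr (_, _).
exact: (stepK c (a, false)).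
Qed.

Lemma last_edgeE w l : last_edge H w l = edge_of (coset_of_word w) l.
Proof.
rewrite /last_edge /edge_of step_right_coset /letter_value /coset_of_word.
by case: l.2; rewrite ?mulg1.
Qed.

Lemma right_cosetP g x : right_coset H g x <-> H (x * g^-1).
Proof.
split=> [[h Hh <-]|Hx]; first by rewrite mulgK.
by exists (x * g^-1) => //; rewrite mulgVK.
Qed.

Lemma subgroup1 : H 1.
Proof. exact/set_mem/hH.1. Qed.

Lemma subgroupM g h : H g -> H h -> H (g * h).
Proof. by move=> /mem_set Hg /mem_set Hh; exact/set_mem/(group_closedM hH). Qed.

Lemma subgroupV g : H g -> H g^-1.
Proof. by move=> /mem_set Hg; exact/set_mem/(group_closedV hH). Qed.

Lemma right_coset_refl g : right_coset H g g.
Proof. by apply/right_cosetP; rewrite mulgV; exact: subgroup1. Qed.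

Lemma right_coset_eq g x : right_coset H g x -> right_coset H x = right_coset H g.
Proof.
move=> /right_cosetP Hx; apply/seteqP; split=> y /right_cosetP Hy; apply/right_cosetP.
  by have := subgroupM Hy Hx; rewrite mulgA mulgVK.
have := subgroupM Hy (subgroupV Hx).
by rewrite invgM invgK mulgA mulgVK.
Qed.

Lemma right_coset1 : right_coset H 1 = H.
Proof.
apply/seteqP; split=> x; first by move/right_cosetP; rewrite invg1 mulg1.
by move=> Hx; apply/right_cosetP; rewrite invg1 mulg1.
Qed.

Lemma coset_of_word_nil : coset_of_word [::] = H.
Proof. by rewrite /coset_of_word value_nil right_coset1. Qed.

Lemma foldl_step_subgroup w : foldl step H w = coset_of_word w.
Proof. by rewrite -right_coset1 foldl_step_right_coset mul1g. Qed.

Lemma vertex_coset_of_word w : vertex (coset_of_word w).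
Proof. by exists (value w). Qed.

Lemma vertex_step c l : vertex c -> vertex (step c l).
Proof.
by move=> [g _ <-]; rewrite step_right_coset; exists (g * letter_value l).
Qed.

Lemma repP c : vertex c -> T (rep c) /\ coset_of_word (rep c) = c.
Proof.
move=> [g _ <-]; have [_ /(_ g)[w [[Tw gw] _]] _ _] := hT.
apply: (@xgetPex _ [::] [set w | T w /\ coset_of_word w = right_coset H g]).
by exists w; split=> //; exact: right_coset_eq.
Qed.

Lemma coset_of_word_inj w w' :
  T w -> T w' -> coset_of_word w = coset_of_word w' -> w = w'.
Proof.
move=> Tw Tw' ww'; have [_ /(_ (value w))[u [_ uP]] _ _] := hT.
rewrite -(uP w) ?(uP w') //; split=> //; last exact: right_coset_refl.
rewrite -/(coset_of_word w) ww'; exact: right_coset_refl.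
Qed.

Lemma rep_coset_of_word w : T w -> rep (coset_of_word w) = w.
Proof.
move=> Tw; have [Tr rE] := repP (vertex_coset_of_word w).
exact: coset_of_word_inj rE.
Qed.

Lemma transversal_words_over w : T w -> words_over X w.
Proof. by move=> Tw; have [/(_ w Tw)[]] := hT. Qed.

Lemma transversal_rcons w l : T (rcons w l) -> T w.
Proof. by rewrite -cats1; have [_ _ _] := hT; apply. Qed.

Lemma rep_subgroup : rep H = [::].
Proof. by rewrite -coset_of_word_nil rep_coset_of_word //; have [] := hT. Qed.

Lemma tree_edge_of w l : T (rcons w l) -> edges tree (edge_of (coset_of_word w) l).
Proof. by move=> Tw; exists w, l; rewrite last_edgeE. Qed.

Lemma nontreeN c l : vertex c -> X l.1 ->
  (edge_of c l \in nontree) = false -> edges tree (edge_of c l).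
Proof.
move=> vc Xl /negP; rewrite in_setE => ne; apply: contrapT => nt; apply: ne.
split=> //; split=> //=; case: l.2 => //; exact: vertex_step.
Qed.

(** Traversing an edge backwards inverts its generator, so one formula serves both directions. *)
Lemma schreier_gen_edge_of c l :
  letter_value (schreier_gen (edge_of c l), l.2) =
  value (rep c) * letter_value l * (value (rep (step c l)))^-1.
Proof.
rewrite /schreier_gen coset_ends_edge_of /letter_value.
by case: l => a [] //=; rewrite !invgM invgK mulgA.
Qed.

(** The far end of a tree edge is represented by the word [rcons w l] itself, so the product
    telescopes. *)
Lemma schreier_gen_tree e : edges tree e -> schreier_gen e = 1.
Proof.
move=> [w [l [Tw ->]]]; rewrite last_edgeE.
have := schreier_gen_edge_of (coset_of_word w) l.
rewrite step_rcons !rep_coset_of_word //; last exact: transversal_rcons Tw.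
rewrite value_rcons mulgV /letter_value; case: l.2 => //= /eqP.
by rewrite invg_eq1 => /eqP.
Qed.

(* The labels, with multiplicity and direction, of the non-tree edges
   traversed when reading w from the coset c. *)
Fixpoint crossings c (w : word F) : seq ((set F * F) * bool) :=
  if w is l :: w' then
    (if edge_of c l \in nontree then [:: (edge_of c l, l.2)] else [::])
      ++ crossings (step c l) w'
  else [::].

Definition gen_word (u : seq ((set F * F) * bool)) : word F :=
  [seq (schreier_gen k.1, k.2) | k <- u].

Lemma crossings_cat c u v :
  crossings c (u ++ v) = crossings c u ++ crossings (foldl step c u) v.
Proof. by elim: u c => //= l u IH c; rewrite IH catA. Qed.

Lemma crossings_winv c w : crossings (foldl step c w) (winv w) = winv (crossings c w).
Proof.
elim: w c => //= l w IH c.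
rewrite winv_cons -cats1 crossings_cat IH foldl_step_winv /= edge_of_linv cats0.
by case: ifP => _ /=; rewrite ?cats0 // winv_cons -cats1.
Qed.

Lemma nontree_crossings c w k : k \in crossings c w -> nontree k.1.
Proof.
elim: w c => //= l' w IH c; rewrite mem_cat => /orP[|/IH//].
by case: ifP => //; rewrite in_setE inE => ? /eqP->.
Qed.

(** The Reidemeister-Schreier rewriting process: inserting the representatives of the intermediate
    cosets makes the product telescope, and the tree edges left out of [crossings] would contribute
    1. *)
Lemma value_crossings c w : vertex c -> words_over X w ->
  value (gen_word (crossings c w)) =
  value (rep c) * value w * (value (rep (foldl step c w)))^-1.
Proof.
elim: w c => [|l w IH] c vc.
  by rewrite /gen_word /= value_nil mulg1 mulgV.
move=> /words_over_cons[Xl Xw].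
rewrite /gen_word /= map_cat value_cat -/(gen_word _).
rewrite IH //; last exact: vertex_step.
have lE := schreier_gen_edge_of c l.
have -> : value (gen_word (if edge_of c l \in nontree then [:: (edge_of c l, l.2)] else [::])) =
    value (rep c) * letter_value l * (value (rep (step c l)))^-1.
  case: ifPn => [_|/negbTE/(nontreeN vc Xl)/schreier_gen_tree e1].
    by rewrite /gen_word /= value_cons value_nil mulg1 lE.
  by rewrite -lE e1 /letter_value /= value_nil; case: l.2; rewrite ?invg1.
by rewrite value_cons !mulgA mulgVK.
Qed.

Lemma schreier_gen_subgroup e : nontree e -> H (schreier_gen e).
Proof.
case: e => c x [[/= vc Xx] _]; have [_ cE] := repP vc.
have vd := vertex_step (x, true) vc; have [_ dE] := repP vd.
rewrite /schreier_gen /=; apply/right_cosetP.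
rewrite -/(coset_of_word _) dE -[c in X in X _]cE.
by exists (value (rep c)) => //; exact: right_coset_refl.
Qed.

(** A word for an element [h] of [H], read from the vertex [H], comes back to [H], whose
    representative is empty; its crossings then spell [h]. *)
Lemma schreier_gen_generates : generated_by (schreier_gen @` nontree) = H.
Proof.
apply/seteqP; split=> h.
  move=> [w Bw <-]; elim: w Bw => [_|l w IH /words_over_cons[[e Me el] /IH Hw]].
    by rewrite value_nil; exact: subgroup1.
  rewrite value_cons; apply: subgroupM => //; rewrite /letter_value -el.
  by case: l.2; last apply: subgroupV; exact: schreier_gen_subgroup.
move=> Hh; have : generated_by X h by rewrite hX.1.
move=> [w Xw wh]; exists (gen_word (crossings H w)).
  by move=> l /mapP[l' /nontree_crossings Ml' ->]; exists l'.1.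
rewrite value_crossings //; last by exists 1; rewrite ?right_coset1.
rewrite foldl_step_subgroup /coset_of_word wh.
have /right_coset_eq -> : right_coset H 1 h by rewrite right_coset1.
by rewrite right_coset1 rep_subgroup value_nil mul1g invg1 mulg1.
Qed.

(** All prefixes of [w] lie in [T], so only tree edges are traversed. *)
Lemma crossings_transversal w : T w -> crossings H w = [::].
Proof.
elim/last_ind: w => // w l IH Twl; rewrite -cats1 crossings_cat IH /=; last first.
  exact: transversal_rcons Twl.
rewrite foldl_step_subgroup; case: ifPn => //.
by rewrite in_setE => -[_ []]; exact: tree_edge_of.
Qed.

(** Read from the vertex [H], this runs along the tree to the origin of [e], crosses [e] and returns
    along the tree. *)
Definition loop e : word F :=
  rep e.1 ++ (e.2, true) :: winv (rep (coset_ends e).2).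

Definition lift (u : seq ((set F * F) * bool)) : word F :=
  flatten [seq if k.2 then loop k.1 else winv (loop k.1) | k <- u].

Lemma value_loop e : value (loop e) = schreier_gen e.
Proof. by rewrite value_cat value_cons value_winv mulgA. Qed.

Lemma value_lift u : value (lift u) = value (gen_word u).
Proof.
elim: u => //= l u IH; rewrite value_cons value_cat IH; congr (_ * _).
by case: l => e []; rewrite /letter_value /= ?value_winv value_loop.
Qed.

Lemma words_over_loop e : nontree e -> words_over X (loop e).
Proof.
move=> [[/= ve Xe] _]; apply/words_over_cat; split.
  exact: transversal_words_over (repP ve).1.
apply/words_over_cons; split=> //; apply: words_over_winv; apply: transversal_words_over.
exact: (repP (vertex_step (e.2, true) ve)).1.
Qed.

Lemma foldl_step_loop e : nontree e -> foldl step H (loop e) = H.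
Proof.
move=> Me; rewrite foldl_step_subgroup /coset_of_word value_loop.
rewrite -[RHS]right_coset1; apply: right_coset_eq.
by rewrite right_coset1; exact: schreier_gen_subgroup.
Qed.

Lemma crossings_loop e : nontree e -> crossings H (loop e) = [:: (e, true)].
Proof.
move=> Me; have [[/= ve Xe] _] := Me.
have [Tr rE] := repP ve; have [Ts sE] := repP (vertex_step (e.2, true) ve).
rewrite crossings_cat crossings_transversal // foldl_step_subgroup rE /=.
have -> : edge_of e.1 (e.2, true) = e by case: (e).
rewrite mem_set //=; congr (_ :: _).
rewrite -[step _ _]sE -foldl_step_subgroup.
by rewrite crossings_winv crossings_transversal.
Qed.

(** Each loop starts and ends at the vertex [H] and crosses a single edge outside the tree, so
    [crossings] inverts [lift] letter by letter. *)
Lemma crossings_lift u : (forall k, k \in u -> nontree k.1) ->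
  crossings H (lift u) = u.
Proof.
elim: u => //= l u IH Mu; rewrite crossings_cat.
have Ml : nontree l.1 by apply: Mu; rewrite inE eqxx.
have -> : foldl step H (if l.2 then loop l.1 else winv (loop l.1)) = H.
  case: l.2; first exact: foldl_step_loop.
  by rewrite -{1}(foldl_step_loop Ml) foldl_step_winv.
rewrite IH; last by move=> l' ul'; apply: Mu; rewrite inE ul' orbT.
rewrite -cat1s; congr (_ ++ _); case: l Ml {Mu} => e [] /= Me.
  exact: crossings_loop.
by rewrite -{1}(foldl_step_loop Me) crossings_winv crossings_loop.
Qed.

(** The letters [l] and [linv l] traverse one edge in opposite directions, which gives a cancelling
    pair of crossings, or no crossing if the edge is in the tree. *)
Lemma normal_form_crossings_cancel u l v :
  normal_form (crossings H (u ++ [:: l, linv l & v])) =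
  normal_form (crossings H (u ++ v)).
Proof.
rewrite !crossings_cat /= edge_of_linv stepK.
by case: ifP => _ //=; exact: normal_form_cancel.
Qed.

(** The word [lift u] has value 1, so it cancels to the empty word over [X]. The normal form of its
    crossings is unchanged on the way, and at the start it is [u]. *)
Lemma schreier_gen_free u : (forall k, k \in u -> nontree k.1) ->
  freely_reduced u -> value (gen_word u) = 1 -> u = [::].
Proof.
move=> Mu red u1; rewrite -(normal_form_id red) -{1}(crossings_lift Mu).
apply: (free_cancel_ind (P := fun w => normal_form (crossings H w) = [::]) hX.2) => //.
- by move=> w l v; rewrite normal_form_crossings_cancel.
- move=> x /flatten_mapP[l ul]; have /words_over_loop Xl := Mu l ul.
  by case: l.2; [exact: Xl | exact: words_over_winv].
- by rewrite value_lift.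
Qed.

(** Two distinct edges with the same generator would give a reduced word of length two with value
    1. *)
Lemma schreier_gen_inj : {in nontree &, injective schreier_gen}.
Proof.
move=> e e' /set_mem Me /set_mem Me' ee'; apply/eqP/negP => /negP ne.
have : [:: (e, true); (e', false)] = [::]; last by [].
apply: schreier_gen_free.
- by move=> l; rewrite !inE => /orP[]/eqP->.
- by rewrite freely_reduced_cons2 andbT /linv xpair_eqE /= andbT eq_sym.
- by rewrite /gen_word /= !value_cons value_nil mulg1 ee' mulgV.
Qed.

Lemma free_basis_schreier_gen : free_basis H (schreier_gen @` nontree).
Proof.
split=> [|w Bw red w1]; first exact: schreier_gen_generates.
pose s x := xget (set0, 1) [set e | nontree e /\ schreier_gen e = x].
have sP x : (schreier_gen @` nontree) x -> nontree (s x) /\ schreier_gen (s x) = x.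
  move=> [e Me ex].
  by apply: (@xgetPex _ (set0, 1) [set e | nontree e /\ _ = x]); exists e.
pose u := [seq (s l.1, l.2) | l <- w].
have uw : gen_word u = w.
  rewrite /gen_word /u -map_comp -[RHS]map_id; apply/eq_in_map => l /Bw/sP[_ /= ->].
  by case: l.
suff u0 : u = [::] by rewrite -uw u0.
apply: schreier_gen_free; last by rewrite uw.
  by move=> l /mapP[l' /Bw/sP[? _] ->].
(* Since [s] is a section of [schreier_gen], a cancelling pair in [u] would yield one in [w]. *)
rewrite /freely_reduced /u sorted_map.
apply: (sub_in_sorted (P := [in w])) red; last exact/allP.
move=> l l' /Bw/sP[_ lE] /Bw/sP[_ l'E] /=.
by apply: contra => /andP[/eqP ss ->]; rewrite andbT -lE -l'E ss.
Qed.

End Schreier.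

Arguments transversal_words_over {F X H T} hT {w}.
Arguments transversal_rcons {F X H T} hT {w l}.
Arguments coset_of_word_inj {F X H T} hH hT {w w'}.

(** * Cardinalities of finite sets *)

Section Cardinality.
Local Open Scope nat_scope.

Lemma fset_setP (A : choiceType) (P : set A) (finP : finite_set P) x :
  reflect (P x) (x \in fset_set P).
Proof.
by rewrite in_fset_set //; apply: (iffP idP); [exact: set_mem | exact: mem_set].
Qed.

Lemma ncard1 (A : choiceType) (x : A) : ncard [set x] = 1.
Proof. by rewrite /ncard fset_set1 cardfs1. Qed.

Lemma ncard_le (A : choiceType) (P Q : set A) :
  finite_set Q -> P `<=` Q -> ncard P <= ncard Q.
Proof.
move=> finQ PQ; apply: fsubset_leq_card.
by rewrite -fset_set_sub //; exact: sub_finite_set finQ.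
Qed.

Lemma ncardU (A : choiceType) (P Q : set A) : finite_set P -> finite_set Q ->
  (forall x, P x -> ~ Q x) -> ncard (P `|` Q) = ncard P + ncard Q.
Proof.
move=> finP finQ PQ; rewrite /ncard fset_setU // cardfsU -fset_setI //.
suff -> : P `&` Q = set0 by rewrite fset_set0 cardfs0 subn0.
by apply/seteqP; split=> // x [/PQ].
Qed.

Lemma ncard_image (A B : choiceType) (f : A -> B) (P : set A) :
  finite_set P -> {in P &, injective f} -> ncard (f @` P) = ncard P.
Proof.
move=> finP injf; rewrite /ncard fset_set_image // card_in_imfset //=.
by move=> x y; rewrite !in_fset_set //; exact: injf.
Qed.

Lemma ncard_bigcup (A I : choiceType) (J : set I) (P : I -> set A) :
  finite_set J -> (forall i, J i -> finite_set (P i)) ->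
  (forall i j x, J i -> J j -> P i x -> P j x -> i = j) ->
  ncard (\bigcup_(i in J) P i) = \sum_(i <- fset_set J) ncard (P i).
Proof.
move=> finJ finP disj; have finU : finite_set (\bigcup_(i in J) P i).
  exact: bigcup_finite.
have -> : ncard (\bigcup_(i in J) P i) =
    #|` (\bigcup_(i <- fset_set J) fset_set (P i))%fset|.
  congr (#|` _|); apply/fsetP => x.
  apply/(fset_setP finU)/bigfcupP => [[i Ji Pix]|[i]].
    by exists i; [rewrite andbT; exact/fset_setP | exact/(fset_setP (finP i Ji))].
  by rewrite andbT => /(fset_setP finJ) Ji /(fset_setP (finP i Ji)) Pix; exists i.
rewrite -sum1_size partition_disjoint_bigfcup.
  by apply: eq_bigr => i _; rewrite sum1_size.
move=> i j /(fset_setP finJ) Ji /(fset_setP finJ) Jj /eqP ij.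
apply/fdisjointP => x /(fset_setP (finP i Ji)) Pi.
by apply/negP => /(fset_setP (finP j Jj)) Pj; apply: ij; exact: disj Pi Pj.
Qed.

Lemma ncardX (A B : choiceType) (P : set A) (Q : set B) :
  finite_set P -> finite_set Q -> ncard (P `*` Q) = ncard P * ncard Q.
Proof.
move=> finP finQ; have -> : P `*` Q = \bigcup_(x in P) (pair x @` Q).
  apply/seteqP; split=> [[x y] [/= Px Qy]|[x y] [x' Px [y' Qy [<- <-]]] //].
  by exists x => //; exists y.
rewrite ncard_bigcup //.
- under eq_bigr => x _ do rewrite ncard_image // => [|y y' _ _ [->//]].
  by rewrite big_const_seq count_predT iter_addn_0 mulnC.
- by move=> x _; exact: finite_image.
- by move=> x x' z _ _ [y _ <-] [y' _ []].
Qed.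

End Cardinality.

(** * Connected components as equivalence classes of vertices *)

Section Components.
Variables (V E : choiceType) (ends : E -> V * V).
Implicit Types G : graph V E.

Lemma adjacent_sym G u v : adjacent ends G u v -> adjacent ends G v u.
Proof. by move=> [e Ge uv]; exists e => //; rewrite orC. Qed.

Lemma connected_sym G u v :
  clos_refl_trans V (adjacent ends G) u v ->
  clos_refl_trans V (adjacent ends G) v u.
Proof.
elim=> [x y xy|x|x y z _ xy _ yz]; first exact/rt_step/adjacent_sym.
  exact: rt_refl.
exact: rt_trans yz xy.
Qed.

Lemma component_eq G C C' v : components ends G C -> components ends G C' ->
  C v -> C' v -> C = C'.
Proof.
move=> [u _ <-] [u' _ <-] /= uv u'v; apply/seteqP; split=> w /= h.
  by apply: rt_trans u'v _; apply: rt_trans h; exact: connected_sym.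
by apply: rt_trans uv _; apply: rt_trans h; exact: connected_sym.
Qed.

Variable K : graph V E.

Lemma component_sub_verts G C :
  subgraph ends G K -> components ends G C -> C `<=` verts G.
Proof.
move=> [_ _ GE] [u Gu <-] v /(Operators_Properties.clos_rt_rtn1 V); elim=> // x y [e Ge exy] _ _.
by have [] := GE e Ge; case: exy => ->.
Qed.

Lemma bigcup_components G : subgraph ends G K ->
  \bigcup_(C in components ends G) C = verts G.
Proof.
move=> subG; apply/seteqP; split=> v.
  by move=> [C GC]; exact: component_sub_verts subG GC v.
move=> Gv; exists [set w | clos_refl_trans V (adjacent ends G) v w].
  by exists v.
exact: rt_refl.
Qed.

End Components.

(** * Counting edge ends in a finite subgraph of a rooted tree *)

Section RootedTree.
Variables (V E : choiceType) (ends : E -> V * V) (K : graph V E).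
Variables (parent : V -> V -> Prop) (depth : V -> nat).
Hypotheses (parent_uniq : forall u u' v, parent u v -> parent u' v -> u = u')
  (parent_depth : forall u v, parent u v -> (depth u < depth v)%N)
  (parent_verts : forall u v, parent u v -> verts K u /\ verts K v)
  (adjacentP : forall u v, adjacent ends K u v <-> parent u v \/ parent v u).

Definition children (C : set V) : set V := [set v | exists2 u, C u & parent u v].

(** These vertices stand for the tree edges whose child end lies in [C]. The parent may lie outside
    [C], so the top vertex of [C] is excluded only when it has no parent at all. *)
Definition nonroot (C : set V) : set V := [set v | C v /\ exists u, parent u v].

(** Take [r] of least depth. A path from [r] can be made to descend: an upward step undoes the
    preceding downward one because parents are unique, and at [r] it would contradict minimality. *)
Lemma component_root (G : graph V E) (C : set V) :
  subgraph ends G K -> components ends G C ->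
  exists r, [/\ C r, forall v, C v -> (depth r <= depth v)%N
    & forall v, C v -> v = r \/ exists2 u, C u & parent u v].
Proof.
move=> [_ subE _] [u0 Gu0 <-]; set C0 := [set v | _].
have C0u0 : C0 u0 by exact: rt_refl.
pose P m := `[< exists2 v, C0 v & depth v = m >].
have exP : exists m, P m by exists (depth u0); apply/asboolP; exists u0.
have [m /asboolP[r C0r <-] minr] := ex_minnP exP.
have {}minr v : C0 v -> (depth r <= depth v)%N.
  by move=> C0v; apply: minr; apply/asboolP; exists v.
exists r; split=> // v C0v.
pose below u v := C0 v /\ parent u v.
suff : clos_refl_trans_n1 V below r v.
  case; first by left.
  move=> u w [_ uw] ru; right; exists u => //.
  by case: ru => // ? ? [].
have : clos_refl_trans V (adjacent ends G) r v.
  by apply: rt_trans C0v; exact: connected_sym.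
move/(Operators_Properties.clos_rt_rtn1 V); elim=> [|u w [e Ge euw] ru IH]; first exact: rtn1_refl.
have C0w : C0 w.
  apply: (@rt_trans _ _ u0 r w C0r); apply: Operators_Properties.clos_rtn1_rt.
  by apply: rtn1_trans ru; exists e.
have /adjacentP[uw|wu] : adjacent ends K u w by exists e => //; exact: subE.
  by apply: rtn1_trans IH; split.
case: IH wu => [wr|u' u2 [_ u'u2] ru' wu2].
  by have := parent_depth wr; rewrite ltnNge minr.
by rewrite (parent_uniq wu2 u'u2).
Qed.

(* Counts the ends at C of the edges of the tree, sorted by the position of the
   child: C has |C| - 1 inner edges, and exactly one edge per boundary vertex. *)
Lemma component_count (G : graph V E) (C : set V) :
  subgraph ends G K -> components ends G C ->
  finite_set C -> finite_set (children C) ->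
  (2 * ncard C + ncard (outer_boundary ends K C) =
   2 + ncard (children C) + ncard (nonroot C))%N.
Proof.
move=> subG GC finC finCh; have [r [Cr minr rP]] := component_root subG GC.
have CE : C = [set r] `|` (C `\ r).
  apply/seteqP; split=> v; last by move=> [->//|[]].
  by move=> Cv; case: (pselect (v = r)) => ?; [left | right].
have finCr : finite_set (C `\ r) by exact: finite_setD.
have finX : finite_set (children C `\` C) by exact: finite_setD.
have ncC : ncard C = (ncard (C `\ r)).+1.
  rewrite {1}CE ncardU //; first by rewrite ncard1.
  by move=> v -> [_]; apply.
have ncCh : ncard (children C) = (ncard (C `\ r) + ncard (children C `\` C))%N.
  rewrite -ncardU //; last by move=> v [Cv _] [_]; apply.
  congr ncard; apply/seteqP; split=> v.
    case: (pselect (C v)) => [Cv [u Cu uv]|nCv hv]; last by right.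
    left; split=> // vr; have := parent_depth uv.
    by rewrite ltnNge vr minr.
  by case=> [[Cv vr]|[]//]; have [] := rP v Cv.
pose Pr := [set u | parent u r].
(* Every vertex of [C] other than [r] has its parent in [C], so apart from a parent of [r] the
   neighbours outside [C] are children. *)
have bdE : outer_boundary ends K C = Pr `|` (children C `\` C).
  apply/seteqP; split=> v.
    move=> [_ nCv [u Cu /adjacentP[uv|vu]]]; first by right; split=> //; exists u.
    by have [ur|[w Cw wu]] := rP u Cu; [left; rewrite /Pr /= -ur
      | case: nCv; rewrite (parent_uniq vu wu)].
  case=> [vr|[[u Cu uv] nCv]]; split=> //.
  - exact: (parent_verts vr).1.
  - by move=> Cv; have := parent_depth vr; rewrite ltnNge minr.
  - by exists r => //; apply/adjacentP; right.
  - exact: (parent_verts uv).2.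
  - by exists u => //; apply/adjacentP; left.
(* If [r] has a parent, the boundary contains it and [nonroot C] is all of [C]; otherwise both
   counts drop by one, and the identity is the same. *)
have [[p pr]|noP] := pselect (exists p, parent p r).
  have PrE : Pr = [set p].
    by apply/seteqP; split=> u /=; [move=> ur; exact: parent_uniq ur pr | move=> ->].
  have nrE : nonroot C = C.
    apply/seteqP; split=> v; first by case.
    move=> Cv; split=> //; have [->|[u _ uv]] := rP v Cv; first by exists p.
    by exists u.
  rewrite bdE nrE ncardU //; last first.
    move=> u; rewrite /Pr /= => ur [[v Cv vu] _].
    have := parent_depth vu; rewrite ltnNge => /negP; apply.
    exact: leq_trans (ltnW (parent_depth ur)) (minr v Cv).
  by rewrite PrE; exact: finite_set1.
  by rewrite PrE ncard1 ncCh ncC; lia.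
have PrE : Pr = set0 by apply/seteqP; split=> // u ur; case: noP; exists u.
have nrE : nonroot C = C `\ r.
  apply/seteqP; split=> v.
    by move=> [Cv [u uv]]; split=> // vr; case: noP; exists u; rewrite -vr.
  move=> [Cv vr]; split=> //; have [//|[u _ uv]] := rP v Cv.
  by exists u.
by rewrite bdE PrE set0U nrE ncCh ncC; lia.
Qed.

(** Components are disjoint, and so are their sets of children because parents are unique. Outer
    boundaries of distinct components may overlap, hence they are summed rather than united. *)
Lemma components_count (G : graph V E) :
  subgraph ends G K -> finite_graph G -> finite_set (children (verts G)) ->
  (2 * ncard (verts G) +
     \sum_(C <- fset_set (components ends G)) ncard (outer_boundary ends K C) =
   2 * alpha ends G + ncard (children (verts G)) + ncard (nonroot (verts G)))%N.
Proof.
move=> subG [finG _] finCh; set cs := components ends G.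
have finI : finite_set cs by exact: finite_image.
have finC C : cs C -> finite_set C.
  by move=> GC; apply: sub_finite_set finG; exact: component_sub_verts subG GC.
have finChC C : cs C -> finite_set (children C).
  move=> GC; apply: sub_finite_set finCh => v [u Cu uv]; exists u => //.
  exact: component_sub_verts subG GC _ Cu.
have vE : ncard (verts G) = (\sum_(C <- fset_set cs) ncard C)%N.
  rewrite -(bigcup_components subG) ncard_bigcup //.
  by move=> C C' v GC GC'; exact: component_eq GC GC'.
have chE : ncard (children (verts G)) = (\sum_(C <- fset_set cs) ncard (children C))%N.
  rewrite -ncard_bigcup //.
    congr ncard; rewrite -(bigcup_components subG); apply/seteqP; split=> v.
      by move=> [u [C GC Cu] uv]; exists C => //; exists u.
    by move=> [C GC [u Cu uv]]; exists u => //; exists C.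
  move=> C C' v GC GC' [u Cu uv] [u' C'u' u'v].
  by apply: (component_eq GC GC' Cu); rewrite (parent_uniq uv u'v).
have nrE : ncard (nonroot (verts G)) = (\sum_(C <- fset_set cs) ncard (nonroot C))%N.
  rewrite -ncard_bigcup //.
  - congr ncard; rewrite -(bigcup_components subG); apply/seteqP; split=> v.
      by move=> [[C GC Cv] pv]; exists C.
    by move=> [C GC [Cv pv]]; split=> //; exists C.
  - by move=> C GC; apply: sub_finite_set (finC C GC) => v [].
  - by move=> C C' v GC GC' [Cv _] [C'v _]; exact: component_eq GC GC' Cv C'v.
have aE : alpha ends G = (\sum_(C <- fset_set cs) 1)%N by rewrite sum1_size.
rewrite vE chE nrE aE !big_distrr -!big_split /=.
rewrite big_seq_cond [RHS]big_seq_cond; apply: eq_bigr => C.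
rewrite andbT in_fset_set // => /set_mem GC; rewrite muln1.
exact: component_count subG GC (finC C GC) (finChC C GC).
Qed.

End RootedTree.

(** * The Schreier tree as a rooted tree, and the edge ends at a finite set of cosets *)

Section SchreierTree.
Variables (F : groupType) (X H : set F) (T : set (word F)).
Hypotheses (hH : group_closed [in H]) (hT : schreier_transversal X H T).
Local Notation tree := (schreier_tree X H T).
Local Notation vertex := (range (right_coset H)).

Definition tree_parent (u v : set F) : Prop := exists w l,
  [/\ T (rcons w l), u = coset_of_word H w & v = coset_of_word H (rcons w l)].

Definition tree_depth (v : set F) : nat := size (rep H T v).

Definition letters : set (F * bool) := [set l | X l.1].

Lemma tree_parent_uniq u u' v : tree_parent u v -> tree_parent u' v -> u = u'.
Proof.
move=> [w [l [Tw -> ->]]] [w' [l' [Tw' -> vE]]].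
by have /rcons_inj[-> _] := coset_of_word_inj hH hT Tw Tw' vE.
Qed.

Lemma tree_parent_depth u v : tree_parent u v -> (tree_depth u < tree_depth v)%N.
Proof.
move=> [w [l [Tw -> ->]]]; rewrite /tree_depth !(rep_coset_of_word hH hT) //.
  by rewrite size_rcons.
exact: (transversal_rcons hT Tw).
Qed.

Lemma tree_parent_verts u v : tree_parent u v -> verts tree u /\ verts tree v.
Proof. by move=> [w [l [_ -> ->]]]; split; exact: vertex_coset_of_word. Qed.

Lemma tree_adjacentP u v :
  adjacent (@coset_ends F) tree u v <-> tree_parent u v \/ tree_parent v u.
Proof.
split.
  move=> [e [w [l [Tw ->]]]]; rewrite last_edgeE coset_ends_edge_of step_rcons.
  by case: l.2 => -[] [<- <-]; [left|right|right|left]; exists w, l.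
have main x y : tree_parent x y -> adjacent (@coset_ends F) tree x y.
  move=> [w [l [Tw -> ->]]]; exists (last_edge H w l); first by exists w, l.
  rewrite last_edgeE coset_ends_edge_of step_rcons.
  by case: l.2; [left | right].
by case=> [/main //|/main]; exact: adjacent_sym.
Qed.

(** A tree edge is the last edge of a transversal word. If that word ends in [l], it extends
    [rep H T c]; if it ends in [linv l], it is [rep H T c] itself. *)
Lemma tree_edgeP c l : vertex c ->
  edges tree (edge_of c l) <->
  T (rcons (rep H T c) l) \/ exists w, rep H T c = rcons w (linv l).
Proof.
move=> vc; have [Tr rE] := repP hH hT vc; split; last first.
  case=> [Tl|[w wE]]; first by rewrite -[c in edge_of c _]rE; exact: tree_edge_of.
  have Tw := Tr; rewrite wE in Tw.
  have := tree_edge_of X H Tw.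
  by rewrite -edge_of_linv linvK step_rcons -wE rE.
move=> [w [l' [Tw]]]; rewrite last_edgeE => ee.
have xx : l.1 = l'.1 by have := congr1 snd ee.
have := congr1 (@coset_ends F) ee; rewrite !coset_ends_edge_of.
have wT := transversal_rcons hT Tw.
have [ll|ll] := eqVneq l.2 l'.2.
  have -> : l = l' by case: (l) (l') xx ll => a b [a' b'] /= -> ->.
  move=> h; have cw : c = coset_of_word H w by case: ifP h => _ [].
  by left; rewrite cw (rep_coset_of_word hH hT).
have lE : l' = linv l.
  by case: (l) (l') xx ll => a b [a' b'] /= -> ; case: b b' => -[].
move=> h; right; exists w.
have cw : c = step (coset_of_word H w) l'.
  by move: h; rewrite lE /=; case: l.2 => /= -[].
by rewrite cw step_rcons (rep_coset_of_word hH hT) // lE.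
Qed.

Lemma nontree_edge_of c l : vertex c -> X l.1 -> ~ edges tree (edge_of c l) ->
  nontree X H T (edge_of c l).
Proof.
move=> vc Xl ne; split=> //; split=> //=.
by case: l.2 => //; exact: vertex_step.
Qed.

Variable V : set (set F).
Hypotheses (finX : finite_set X) (finV : finite_set V) (subV : V `<=` vertex).

Lemma finite_letters : finite_set letters.
Proof.
have -> : letters = X `*` [set: bool] by apply/seteqP; split=> l //= [].
exact: finite_setX.
Qed.

Lemma ncard_letters : ncard letters = (2 * ncard X)%N.
Proof.
have -> : letters = X `*` ([set true] `|` [set false]).
  by apply/seteqP; split=> [[a []]|[a b]] /=; [split; [|left]|split; [|right]|case].
rewrite ncardX // ncardU // ?ncard1; first by rewrite mulnC.
by move=> b ->.
Qed.

Lemma finite_children : finite_set (children tree_parent V).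
Proof.
apply: (@sub_finite_set _ _ ((fun d => step d.1 d.2) @` (V `*` letters))).
  move=> v [u Vu [w [l [Tw uE ->]]]]; exists (u, l); last by rewrite uE /= step_rcons.
  split=> //; apply: (transversal_words_over hT Tw).
  by rewrite mem_rcons inE eqxx.
by apply: finite_image; apply: finite_setX => //; exact: finite_letters.
Qed.

(** Together with [edges_to] this counts ends: an edge outside the tree with both ends in [V], in
    particular a loop, belongs to both sets. *)
Definition edges_from : set (set F * F) := [set e | nontree X H T e /\ V e.1].

Definition edges_to : set (set F * F) :=
  [set e | nontree X H T e /\ V (coset_ends e).2].

Lemma finite_edges_from : finite_set edges_from.
Proof.
apply: (@sub_finite_set _ _ (V `*` X)); last exact: finite_setX.
by move=> e [[[_ Xe] _] Ve].
Qed.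

Lemma finite_edges_to : finite_set edges_to.
Proof.
apply: (@sub_finite_set _ _ ((fun d => edge_of d.1 (d.2, false)) @` (V `*` X))).
  move=> e [[[_ Xe] _] Ve]; exists ((coset_ends e).2, e.2) => //.
  have := edge_of_linv e.1 (e.2, true); rewrite /linv /= => ->.
  by case: (e).
by apply: finite_image; exact: finite_setX.
Qed.

(** Pairs of a vertex in [V] and a letter are the edge ends at [V]. Each is the parent end or the
    child end of a tree edge, or the origin or the target of an edge outside the tree. *)
Lemma darts_count :
  (2 * ncard X * ncard V = ncard (children tree_parent V)
     + ncard (nonroot tree_parent V) + (ncard edges_from + ncard edges_to))%N.
Proof.
have finD : finite_set (V `*` letters).
  by apply: finite_setX => //; exact: finite_letters.
(* A dart is in [down] when its letter extends the representative and in [up] when it deletes the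
   last letter; [out] and [inn] give the two darts of an edge. *)
pose down := [set d : set F * (F * bool) | V d.1 /\ T (rcons (rep H T d.1) d.2)].
pose up := [set d : set F * (F * bool) | V d.1 /\ exists w, rep H T d.1 = rcons w (linv d.2)].
pose out (e : set F * F) := (e.1, (e.2, true)).
pose inn (e : set F * F) := ((coset_ends e).2, (e.2, false)).
have repV c : V c -> T (rep H T c) /\ coset_of_word H (rep H T c) = c.
  by move=> /subV /(repP hH hT).
have downE d : V d.1 -> step d.1 d.2 = coset_of_word H (rcons (rep H T d.1) d.2).
  by move=> /repV[_ {1}<-]; rewrite step_rcons.
have subdown : down `<=` V `*` letters.
  move=> d [Vd Td]; split=> //; apply: (transversal_words_over hT Td).
  by rewrite mem_rcons inE eqxx.
have subup : up `<=` V `*` letters.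
  move=> d [Vd [w wE]]; split=> //.
  have := transversal_words_over hT (repV _ Vd).1.
  by rewrite wE => /(_ (linv d.2)); apply; rewrite mem_rcons inE eqxx.
have subfrom : out @` edges_from `<=` V `*` letters.
  by move=> _ [e [[[_ Xe] _] Ve] <-].
have subto : inn @` edges_to `<=` V `*` letters.
  by move=> _ [e [[[_ Xe] _] Ve] <-].
have treeE d : V d.1 -> edges tree (edge_of d.1 d.2) <-> down d \/ up d.
  move=> Vd; split; first by move/(tree_edgeP _ (subV Vd))=> -[]; [left | right].
  by move=> h; apply/(tree_edgeP _ (subV Vd)); case: h => -[_]; [left | right].
have outE e : edge_of (out e).1 (out e).2 = e by case: e.
have innE e : edge_of (inn e).1 (inn e).2 = e.
  by rewrite -[RHS]outE -[in RHS]edge_of_linv.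
have chE : ncard (children tree_parent V) = ncard down.
  rewrite -(@ncard_image _ _ (fun d => step d.1 d.2)).
  - congr ncard; apply/seteqP; split=> v.
      move=> [u Vu [w [l [Tw uE ->]]]]; exists (u, l); last by rewrite uE /= step_rcons.
      split=> //=; rewrite uE (rep_coset_of_word hH hT) //.
      exact: (transversal_rcons hT Tw).
    move=> [d [Vd Td] <-]; exists d.1 => //; exists (rep H T d.1), d.2.
    by split=> //; [rewrite (repV _ Vd).2 | rewrite downE].
  - exact: sub_finite_set finD.
  move=> [c l] [c' l'] /set_mem[/= Vc Tc] /set_mem[/= Vc' Tc'].
  rewrite (downE (c, l)) // (downE (c', l')) //= => /(coset_of_word_inj hH hT Tc Tc').
  by move=> /rcons_inj[cc ->]; rewrite -(repV _ Vc).2 -(repV _ Vc').2 cc.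
have nrE : ncard (nonroot tree_parent V) = ncard up.
  rewrite -(@ncard_image _ _ fst).
  - congr ncard; apply/seteqP; split=> v.
      move=> [Vv [u [w [l [Tw _ vE]]]]]; exists (v, linv l) => //; split=> //=.
      by exists w; rewrite linvK vE (rep_coset_of_word hH hT).
    move=> [[c l] [/= Vc [w wE]] <-]; split=> //=.
    have [Tc cE] := repV _ Vc.
    exists (coset_of_word H w), w, (linv l); split=> //; first by rewrite -wE.
    by rewrite -wE cE.
  - exact: sub_finite_set finD.
  move=> [c l] [c' l'] /set_mem[/= _ [w wE]] /set_mem[/= _ [w' w'E]] cc.
  move: wE; rewrite cc w'E => /rcons_inj/(congr1 snd).
  by move/(can_inj (@linvK _)) => ->.
have fromE : ncard edges_from = ncard (out @` edges_from).
  rewrite ncard_image //; first exact: finite_edges_from.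
  by move=> [c x] [c' x'] _ _ [-> ->].
have toE : ncard edges_to = ncard (inn @` edges_to).
  rewrite ncard_image //; first exact: finite_edges_to.
  by move=> e e' _ _ ee; rewrite -(innE e) -(innE e') ee.
have finS := sub_finite_set _ finD.
rewrite -ncard_letters mulnC -ncardX //; last exact: finite_letters.
rewrite chE nrE fromE toE.
rewrite -ncardU; [|exact: finS..|]; last first.
  (* For a dart in both sets, two transversal words whose lengths differ by two would represent the
     same coset. *)
  move=> d [Vd Td] [_ [w wE]].
  have [Tc cE] := repV _ Vd; rewrite wE in Tc.
  have Tw := transversal_rcons hT Tc.
  have : coset_of_word H w = coset_of_word H (rcons (rep H T d.1) d.2).
    by rewrite -downE // -[X in step X _]cE wE -step_rcons step_linvK.
  move/(coset_of_word_inj hH hT Tw Td)/(congr1 size).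
  by rewrite wE !size_rcons; lia.
rewrite -ncardU; [|exact: finS..|]; last first.
  by move=> _ [e _ <-] [e' _ []].
rewrite -ncardU; [|by rewrite finite_setU; split; exact: finS..|]; last first.
  move=> d dtree nd; have Vd : V d.1 by case: dtree => -[].
  have /(treeE _ Vd) te : down d \/ up d by case: dtree; [left | right].
  case: nd te => -[e [Me _] <-]; rewrite ?outE ?innE; exact: Me.2.
congr ncard; apply/seteqP; split=> d; last first.
  by case=> -[]; [exact: subdown|exact: subup|exact: subfrom|exact: subto].
move=> [Vd Xd]; have [/(treeE _ Vd) te|nte] := pselect (edges tree (edge_of d.1 d.2)).
  by left.
right; have Me := nontree_edge_of (subV Vd) Xd nte.
case: d Vd Xd nte Me {repV} => c [x []] Vd Xd nte Me.
  by left; exists (c, x).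
right; exists (edge_of c (x, false)).
  by split=> //; rewrite coset_ends_edge_of.
by rewrite /inn coset_ends_edge_of.
Qed.

End SchreierTree.

(** * Passage to the limit *)

Lemma eventually_sub_verts (V E : choiceType) (K : graph V E)
    (G : nat -> graph V E) (A : set V) :
  is_liminf K G -> finite_set A -> A `<=` verts K ->
  exists N : nat, forall i, (N <= i)%N -> A `<=` verts (G i).
Proof.
move=> [vK _] finA AK; pose N v := xget 0%N [set m | forall j, (m <= j)%N -> verts (G j) v].
have NP v : A v -> forall j, (N v <= j)%N -> verts (G j) v.
  move=> /AK; rewrite vK => -[m _ mv].
  by apply: (@xgetPex _ 0%N [set m | forall j, (m <= j)%N -> verts (G j) v]); exists m.
(* Each vertex of [A] has a threshold beyond which it stays in the subgraphs; as [A] is finite, the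
   largest one serves for all. *)
exists (\max_(v <- fset_set A) N v)%N => i Ni v Av; apply: NP => //.
by apply: leq_trans Ni; apply: leq_bigmax_seq => //; exact/fset_setP.
Qed.

Local Open Scope ring_scope.

Theorem proposition2p1 (R : realType) (F : groupType) (n : nat) (X : set F)
    (hX : free_basis [set: F] X) (hn : (X #= `I_n)%card)
    (H : set F) (hH : group_closed [in H])
    (T : set (word F)) (hT : schreier_transversal X H T)
    (T_ : nat -> graph (set F) (set F * F))
    (hsub : forall i, subgraph (@coset_ends F) (T_ i) (schreier_tree X H T))
    (hfin : forall i, finite_graph (T_ i))
    (hlim : is_liminf (schreier_tree X H T) T_) :
  let a i : R :=
    (alpha (@coset_ends F) (T_ i))%:R
    + (n%:R - 1) * (ncard (verts (T_ i)))%:R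
    - 2^-1 * \sum_(C \in components (@coset_ends F) (T_ i))
        ((ncard (outer_boundary (@coset_ends F) (schreier_tree X H T) C))%:R : R) in
  (a i)%:E @[i --> \oo] --> rank R H /\
  (~ finitely_generated H -> rank R H = +oo%E).
Proof.
move=> a.
have finX : finite_set X by exists n.
have nX : ncard X = n by exact: card_fset_set.
have freeB := free_basis_schreier_gen hX hH hT.
rewrite (rank_free_basis R freeB); set M := nontree X H T in freeB *.
split; last first.
  move=> nfg; rewrite /counting; case: asboolP => // finB.
  by case: nfg; exists (schreier_gen H T @` M); last exact: freeB.1.
pose Vi i := verts (T_ i); pose from i := edges_from X H T (Vi i).
pose to i := edges_to X H T (Vi i).
have finV i : finite_set (Vi i) by have [] := hfin i.
have subV i : Vi i `<=` range (right_coset H) by have [] := hsub i.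
have finfrom i : finite_set (from i) by exact: finite_edges_from.
have finto i : finite_set (to i) by exact: finite_edges_to.
(* The numbers of children and of nonroot vertices enter both counts with the same sum. Eliminating
   it leaves the ends of edges outside the tree. *)
have aE i : a i = 2^-1 * ((ncard (from i))%:R + (ncard (to i))%:R).
  have := components_count (tree_parent_uniq hH hT) (tree_parent_depth hH hT)
    (@tree_parent_verts _ X H T) (tree_adjacentP X H T) (hsub i) (hfin i)
    (finite_children hT finX (finV i)).
  have := darts_count hH hT finX (finV i) (subV i).
  rewrite -/(from i) -/(to i) -/(Vi i) nX /a.
  rewrite fsbig_finite /=; last by apply: finite_image; exact: finV.
  rewrite -natr_sum -/(Vi i); set S := (\sum_(_ <- _) _)%N.
  set al := alpha _ _; set v := ncard (Vi i).
  move: (ncard _) (ncard _) (ncard _) (ncard _) => f t c r.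
  move=> /(congr1 (fun m => m%:R : R)); rewrite /= !natrD !natrM => e1.
  move=> /(congr1 (fun m => m%:R : R)); rewrite /= natrD natrM 2!natrD natrM => e2.
  by lra.
have target_vertex e : M e -> range (right_coset H) (coset_ends e).2.
  by move=> [[/= ve _] _]; exact: (vertex_step (e.2, true) ve).
(* The ends of finitely many edges are finitely many vertices of the tree, which has every coset as
   a vertex, so [T_ i] eventually contains them all. *)
have contained (A : set (set F * F)) : finite_set A -> A `<=` M ->
    exists N : nat, forall i, (N <= i)%N -> A `<=` from i /\ A `<=` to i.
  move=> finA AM; pose ends_A := (fst @` A) `|` ((fun e => (coset_ends e).2) @` A).
  have [||N NP] := @eventually_sub_verts _ _ _ _ ends_A hlim.
  - by rewrite finite_setU; split; exact: finite_image.
  - by move=> v [] [e /AM Me <-]; [exact: Me.1.1 | exact: target_vertex].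
  exists N => i /NP NA; split=> e Ae; split; try exact: AM.
    by apply: NA; left; exists e.
  by apply: NA; right; exists e.
have [finM|infM] := pselect (finite_set M).
  have finB : finite_set (schreier_gen H T @` M) by exact: finite_image.
  rewrite /counting asboolT // -/(ncard _) ncard_image //; last first.
    exact: schreier_gen_inj hX hH hT.
  have [N NP] := contained M finM (fun x => id).
  (* Eventually every edge of [M] is counted once at each end, so the sequence is constant from
     there on. *)
  apply: cvg_near_cst; exists N => // i /= /NP[fromM toM].
  have -> : a i = (ncard M)%:R; last by [].
  have fE : from i = M by apply/seteqP; split=> // e [].
  have tE : to i = M by apply/seteqP; split=> // e [].
  by rewrite aE fE tE; lra.
rewrite /counting asboolF; last first.
  apply: contra_not infM => finB.
  by rewrite -(eq_finite_set (inj_card_eq (schreier_gen_inj hX hH hT))).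
apply/cvgeyPge => A.
(* More than [A] edges outside the tree are eventually counted by both [from i] and [to i], so the
   mean of the two counts is at least [A]. *)
have [D DM AD] := infinite_set_fset (Num.truncn A).+1 infM.
have [N NP] := contained _ (finite_fset D) DM.
exists N => // i /= /NP[Df Dt]; rewrite lee_fin aE.
have le B : finite_set B -> [set` D] `<=` B -> A <= (ncard B)%:R.
  move=> finB DB; have := ncard_le finB DB; rewrite /ncard set_fsetK => DB'.
  apply: (@le_trans _ _ (Num.truncn A).+1%:R); first exact/ltW/truncnS_gt.
  by rewrite ler_nat (leq_trans AD).
have := le _ (finfrom i) Df; have := le _ (finto i) Dt; by lra.
Qed.
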